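(* Let $n\in\mathbb{N}$, with $n=2\nu$ if $n$ is even and $n=2\nu+1$ if $n$ is odd. A matrix $M\in\mathbb{R}^{n\times n}$ is an element of $B_n$ if and only if $$M=\mathcal{X}_n\begin{pmatrix}\Upsilon&\mathcal{O}\\ \mathcal{O}&\Omega\end{pmatrix}\mathcal{X}_n$$ with some matrices $\Upsilon,\Omega\in\mathbb{R}^{\nu\times\nu}$ if $n=2\nu$ is even, and $\Upsilon\in\mathbb{R}^{(\nu+1)\times(\nu+1)}$, $\Omega\in\mathbb{R}^{\nu\times\nu}$ if $n=2\nu+1$ is odd, and null matrices $\mathcal{O}$ of matching size.
   Context: $B_n$ is the space of matrices $M\in\mathbb{R}^{n\times n}$ with $M_{i,j}=M_{n+1-i,n+1-j}$ for all $i,j\in\{1,\dots,n\}$. $\mathcal{I}_\nu$ is the $\nu\times\nu$ unit matrix, $0_\nu\in\mathbb{R}^\nu$ the null (column) vector, $\mathcal{J}_\nu=(\delta_{i,\nu+1-j})_{i,j=1}^\nu$ (ones on the antidiagonal, zeros elsewhere), and $$\mathcal{X}_n=\frac1{\sqrt2}\begin{pmatrix}\mathcal{I}_\nu&\mathcal{J}_\nu\\ \mathcal{J}_\nu&-\mathcal{I}_\nu\end{pmatrix}\ (n=2\nu),\qquad \mathcal{X}_n=\begin{pmatrix}\frac1{\sqrt2}\mathcal{I}_\nu&0_\nu&\frac1{\sqrt2}\mathcal{J}_\nu\\ 0_\nu^T&1&0_\nu^T\\ \frac1{\sqrt2}\mathcal{J}_\nu&0_\nu&-\frac1{\sqrt2}\mathcal{I}_\nu\end{pmatrix}\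 (n=2\nu+1).$$ *)

(* Defs.v *)
From mathcomp Require Import all_boot all_order all_algebra.
From mathcomp Require Import reals.

Import GRing.Theory Num.Theory.
Local Open Scope ring_scope.

(** Indices are 0-based, so [rev_ord] is the reflection [i |-> n + 1 - i] of
    [{1, ..., n}]. *)
Definition Bspace (R : realType) (n : nat) : {pred 'M[R]_n} :=
  [pred M : 'M[R]_n | [forall i, forall j, M i j == M (rev_ord i) (rev_ord j)]].

Definition Jmx (R : realType) (nu : nat) : 'M[R]_nu :=
  \matrix_(i, j) (i == rev_ord j)%:R.

(** The matrix [X_n] is given by two families, indexed by [nu], so that its
    dimension [nu + nu] or [nu + 1 + nu] carries the block structure and no
    cast is needed. *)
Definition Xeven (R : realType) (nu : nat) : 'M[R]_(nu + nu) :=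
  (Num.sqrt 2)^-1 *: block_mx 1%:M         (Jmx R nu)
                              (Jmx R nu)   (- 1%:M).

Definition Xodd (R : realType) (nu : nat) : 'M[R]_(nu + 1 + nu) :=
  let s : R := (Num.sqrt 2)^-1 in
  block_mx
    (block_mx (s *: 1%:M) (0 : 'cV[R]_nu)
              (0 : 'rV[R]_nu) 1%:M)         (col_mx (s *: Jmx R nu) (0 : 'rV[R]_nu))
    (row_mx (s *: Jmx R nu) (0 : 'cV[R]_nu))  (- (s *: 1%:M)).

(* Main.v *)
(** [M] lies in [B_n] iff it commutes with the exchange matrix [J_n].  The matrix
    [X_n] is an involution with [J_n X_n = X_n D], where [D = diag(I, -I)]; hence
    [M] commutes with [J_n] iff [X_n M X_n] commutes with [D], that is, iff the
    off-diagonal blocks of [X_n M X_n] vanish. *)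
Require Import Defs.
From mathcomp Require Import all_boot all_order all_algebra.
From mathcomp Require Import reals.
From mathcomp Require Import zify.

Import GRing.Theory Num.Theory.
Local Open Scope ring_scope.

Lemma mul_Jmx (R : realType) (n p : nat) (M : 'M[R]_(n, p)) i j :
  (Jmx R n *m M) i j = M (rev_ord i) j.
Proof.
rewrite mxE (bigD1 (rev_ord i)) //= big1 => [|k nk]; rewrite !mxE ?rev_ordK.
  by rewrite eqxx mul1r addr0.
by rewrite -(inj_eq rev_ord_inj) rev_ordK eq_sym (negPf nk) mul0r.
Qed.

Lemma mulmx_J (R : realType) (n p : nat) (M : 'M[R]_(p, n)) i j :
  (M *m Jmx R n) i j = M i (rev_ord j).
Proof.
rewrite mxE (bigD1 (rev_ord j)) //= big1 => [|k nk]; rewrite !mxE.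
  by rewrite eqxx mulr1 addr0.
by rewrite (negPf nk) mulr0.
Qed.

Lemma JmxK (R : realType) (n : nat) : Jmx R n *m Jmx R n = 1%:M.
Proof.
by apply/matrixP => i j; rewrite mul_Jmx !mxE (inj_eq rev_ord_inj).
Qed.

(** Left multiplication by [Jmx] reflects row indices and right multiplication reflects column
    indices. The defining symmetry of [Bspace], read at the reflected column, equates the two
    products. *)
Lemma BspaceP (R : realType) (n : nat) (M : 'M[R]_n) :
  M \in Bspace R n <-> comm_mx (Jmx R n) M.
Proof.
rewrite /comm_mx; split=> [/forallP MB | JM].
  apply/matrixP => i j; rewrite mul_Jmx mulmx_J.
  by have /forallP/(_ (rev_ord j))/eqP -> := MB i; rewrite rev_ordK.
apply/forallP => i; apply/forallP => j; apply/eqP.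
by rewrite -mul_Jmx JM mulmx_J rev_ordK.
Qed.

(** The two products agree on the diagonal blocks and differ by a sign on the off-diagonal ones, so
    those blocks equal their own negatives and vanish over the reals. *)
Lemma comm_mx_sign_block (R : realType) (m p : nat) (N : 'M[R]_(m + p)) :
  comm_mx (block_mx 1%:M 0 0 (- 1%:M)) N <->
  exists (U : 'M[R]_m) (W : 'M[R]_p), N = block_mx U 0 0 W.
Proof.
have self_opp0 k l (A : 'M[R]_(k, l)) : - A = A -> A = 0.
  move=> AN; apply/matrixP => i j; rewrite mxE; apply/eqP.
  by rewrite -eqNr -[X in _ == X](congr1 (fun B : 'M_(k, l) => B i j) AN) mxE.
rewrite /comm_mx; split=> [|[U [W ->]]]; last first.
  by rewrite !mulmx_block !(mul1mx, mulmx1, mul0mx, mulmx0, mulNmx, mulmxN,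
    addr0, add0r, oppr0).
rewrite -[N]submxK !mulmx_block !(mul1mx, mulmx1, mul0mx, mulmx0, mulNmx,
  mulmxN, addr0, add0r).
case/eq_block_mx => _ /esym/self_opp0 -> /self_opp0 -> _.
by exists (ulsubmx N), (drsubmx N).
Qed.

(** The argument common to both parities: only the involution property and the intertwining relation
    depend on the shape of [X]. *)
Lemma comm_mx_conj_block (R : realType) (m p : nat) (J X M : 'M[R]_(m + p)) :
  X *m X = 1%:M -> J *m X = X *m block_mx 1%:M 0 0 (- 1%:M) ->
  comm_mx J M <->
  exists (U : 'M[R]_m) (W : 'M[R]_p), M = X *m block_mx U 0 0 W *m X.
Proof.
set D := block_mx _ _ _ _ => XX JX.
have XK (A : 'M[R]_(m + p)) : X *m (X *m A) = A by rewrite mulmxA XX mul1mx.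
have KX (A : 'M[R]_(m + p)) : A *m X *m X = A by rewrite -mulmxA XX mulmx1.
(* The mirrored relation follows from [X *m J = X *m (J *m X) *m X], without any symmetry of [X] or
   [J]. *)
have XJ : X *m J = D *m X by rewrite -[J in LHS]KX JX -mulmxA XK.
have -> : comm_mx J M <-> comm_mx D (X *m M *m X).
  rewrite /comm_mx; split=> [JM | DN].
    by rewrite !mulmxA -XJ -[X *m J *m M]mulmxA JM -!mulmxA JX.
  (* Conjugating once more by the involution [X] returns to [J] and [M]. *)
  have := congr1 (fun A => X *m A *m X) DN.
  by rewrite !mulmxA -JX KX XX mul1mx KX -!mulmxA -XJ [X *m (X *m _)]XK.
rewrite comm_mx_sign_block; split=> -[U [W E]]; exists U, W.
  by rewrite -E -!mulmxA XX mulmx1 XK.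
by rewrite E !mulmxA XX mul1mx KX.
Qed.

Lemma sqrt2V_halves (R : realType) :
  (Num.sqrt 2 : R)^-1 * (Num.sqrt 2)^-1 + (Num.sqrt 2)^-1 * (Num.sqrt 2)^-1 = 1.
Proof.
rewrite -mulr2n -expr2 exprVn sqr_sqrtr ?ler0n // -[LHS]mulr_natr mulVf //.
by rewrite pnatr_eq0.
Qed.

Lemma Jmx_even (R : realType) (nu : nat) :
  Jmx R (nu + nu) = block_mx 0 (Jmx R nu) (Jmx R nu) 0.
Proof.
apply/matrixP => i j; rewrite !mxE -val_eqE /=.
case: splitP => i' ->; rewrite mxE; case: splitP => j' ->; rewrite !mxE;
  have := ltn_ord i'; have := ltn_ord j'; rewrite -?val_eqE /= => *;
  (* On an antidiagonal block both index equations are equivalent; on a zero block the reflected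
     index falls outside the block. *)
  first [congr (nat_of_bool _)%:R; lia | rewrite (_ : (_ == _) = false) //; lia].
Qed.

(** The middle index is its own reflection, whence the central entry 1. *)
Lemma Jmx_odd (R : realType) (nu : nat) :
  Jmx R (nu + 1 + nu) =
  block_mx (block_mx 0 0 0 1%:M) (col_mx (Jmx R nu) 0) (row_mx (Jmx R nu) 0) 0.
Proof.
apply/matrixP => i j; rewrite !mxE -val_eqE /=.
case: splitP => i1 ->; rewrite mxE; case: splitP => j1 ->; rewrite !mxE;
  try (case: splitP => i2 Ei2; rewrite !mxE; have := ltn_ord i2);
  try (case: splitP => j2 Ej2; rewrite !mxE; have := ltn_ord j2);
  have := ltn_ord i1; have := ltn_ord j1;
  rewrite -?val_eqE /= => *;
  first [congr (nat_of_bool _)%:R; lia | rewrite (_ : (_ == _) = false) //; lia].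
Qed.

(** Off the diagonal [Jmx] cancels against itself; on it two identity matrices add up, each with
    weight one half. *)
Lemma XevenK (R : realType) (nu : nat) : Xeven R nu *m Xeven R nu = 1%:M.
Proof.
rewrite /Xeven -scalemxAl -scalemxAr scalerA mulmx_block.
rewrite !(mul1mx, mulmx1, mulNmx, mulmxN, opprK, JmxK, subrr).
rewrite scale_block_mx scaler0 scalerDr -scalerDl sqrt2V_halves scale1r.
by rewrite -scalar_mx_block.
Qed.

(** The first [nu] columns of [Xeven] are symmetric under reflection, the last [nu] antisymmetric:
    eigenvectors for 1 and -1. *)
Lemma Jmx_Xeven (R : realType) (nu : nat) :
  Jmx R (nu + nu) *m Xeven R nu = Xeven R nu *m block_mx 1%:M 0 0 (- 1%:M).
Proof.
rewrite Jmx_even /Xeven -scalemxAl -scalemxAr !mulmx_block.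
by rewrite !(mul1mx, mulmx1, mul0mx, mulmx0, mulNmx, mulmxN, opprK, JmxK,
  addr0, add0r, oppr0).
Qed.

Lemma XoddK (R : realType) (nu : nat) : Xodd R nu *m Xodd R nu = 1%:M.
Proof.
rewrite /Xodd /=; set s := (Num.sqrt 2)^-1.
rewrite !mulmx_block mul_col_row mul_row_block mul_block_col mul_col_mx.
rewrite mul_mx_row mul_row_col !(mulNmx, mulmxN) opprK.
rewrite -!(scalemxAl, scalemxAr) !(mul1mx, mulmx1, mul0mx, mulmx0, JmxK).
rewrite !(scaler0, oppr0, addr0, add0r) add_block_mx add_col_mx add_row_mx.
rewrite !scalerA !subrr !addr0 -!scalerDl sqrt2V_halves !scale1r.
by rewrite col_mx0 row_mx0 -!scalar_mx_block.
Qed.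

(** The middle column is a unit vector fixed by the reflection, so it joins the eigenvalue 1; this
    is why the first block has size [nu + 1]. *)
Lemma Jmx_Xodd (R : realType) (nu : nat) :
  Jmx R (nu + 1 + nu) *m Xodd R nu = Xodd R nu *m block_mx 1%:M 0 0 (- 1%:M).
Proof.
rewrite Jmx_odd /Xodd /=; set s := (Num.sqrt 2)^-1.
rewrite !mulmx_block mul_col_row mul_row_block mul_block_col mul_col_mx.
rewrite mul_mx_row mul_row_col !(mulNmx, mulmxN) opprK -!scalemxAr.
rewrite !(mul1mx, mulmx1, mul0mx, mulmx0, JmxK).
rewrite !(scaler0, oppr0, addr0, add0r, row_mx0, col_mx0) add_block_mx.
by rewrite !(addr0, add0r) opp_col_mx oppr0.
Qed.

Theorem lemma6 (R : realType) (nu : nat) :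
  (forall M : 'M[R]_(nu + nu),
     M \in Bspace R (nu + nu) <->
     exists (Upsilon : 'M[R]_nu) (Omega : 'M[R]_nu),
       M = Xeven R nu *m block_mx Upsilon 0 0 Omega *m Xeven R nu)
  /\
  (forall M : 'M[R]_(nu + 1 + nu),
     M \in Bspace R (nu + 1 + nu) <->
     exists (Upsilon : 'M[R]_(nu + 1)) (Omega : 'M[R]_nu),
       M = Xodd R nu *m block_mx Upsilon 0 0 Omega *m Xodd R nu).
Proof.
split=> M; rewrite BspaceP.
  exact: comm_mx_conj_block (XevenK R nu) (Jmx_Xeven R nu).
exact: comm_mx_conj_block (XoddK R nu) (Jmx_Xodd R nu).
Qed.
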